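(* Let $F:\mathcal W\to\mathbb R^d$ be $L$-Lipschitz in the sense that $\|F(w)-F(v)\|_*\le L\|w-v\|$ for all $w,v\in\mathcal W$ ($L>0$), and let the norm $\|\cdot\|$ satisfy the norm assumption with constants $0<\gamma\le 1$, $\delta>0$ (see context). Let $w_0\in\mathcal W$ and suppose either (i) $\sigma=0$ and $w^*\in\mathcal W$ is a weak solution, i.e. $\langle F(w),w-w^*\rangle\ge 0$ for all $w\in\mathcal W$; or (ii) $\sigma>0$ and $w^*\in\mathcal W$ is a $\sigma$-weak solution, i.e. $\langle F(w),w-w^*\rangle\ge\frac{\sigma}{\gamma}\big(V_{w-w_0}(w^*-w_0)+V_{w^*-w_0}(w-w_0)\big)$ for all $w\in\mathcal W$. Let $D>0$, $K\ge 1$, and run the OptDE algorithm (see context) from $w_0$ for $K$ iterations with these $L,\gamma,\sigma$ and a parameter $0<\alpha\le\min\{\frac1{4\sqrt2},\frac{\sqrt3}{4\sqrt\gamma}\}$. Then its output $\tilde w_K$ satisfies $$\sup_{w\in\mathcal W,\ \|\tilde w_K-w\|\le D}\langle F(\tilde w_K),\tilde w_K-w\rangle\le C_0D\|w_0-w^*\|\sqrt{\frac{L}{A_{K-1}+a_1}},$$ where $C_0=\big(1+\frac{\delta}{\alpha\gamma}\big)\sqrt{\frac{8\alpha}{\gamma}}$, $a_1=\frac{\alpha\gamma}{L}$, and $$A_{K-1}=\begin{cases}\frac{\alpha\gamma(K-1)}{L}&\text{if }\sigma=0,\\[2pt] \frac1\sigma\big(1+\frac{\alpha\gamma\sigma}{L}\big)^{K-1}-\frac1\sigma&\text{if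 }\sigma>0.\end{cases}$$ If moreover $\sigma>0$, then also $$\|\tilde w_K-w^*\|\le\frac{C_0}{\sigma}\|w_0-w^*\|\sqrt{\frac{L}{A_{K-1}+a_1}}.$$
   Context: $\mathcal W\subset\mathbb R^d$ is a (nonempty) closed convex set, $\|\cdot\|$ is a norm on $\mathbb R^d$ (possibly non-Euclidean), $\|y\|_*=\max_{\|x\|\le1}\langle x,y\rangle$ is its dual norm, and $\phi(x)=\frac12\|x\|^2$, with gradient $\nabla\phi$. Norm assumption with constants $0<\gamma\le1$, $\delta>0$: for all $w,v$, $\phi(w)\ge\phi(v)+\langle\nabla\phi(v),w-v\rangle+\frac\gamma2\|w-v\|^2$ and $\|\nabla\phi(w)\|_*\le\delta\|w\|$. Bregman divergence: $V_v(w)=\phi(w)-\phi(v)-\langle\nabla\phi(v),w-v\rangle$. Prox-mapping: $P_v(w)=\arg\min_{z\in\mathcal W}\{\langle w,z\rangle+\frac1{2\gamma}\|z-v\|^2\}$. OptDE algorithm (Optimistic Dual Extrapolation): given $L,\gamma,\sigma\ge0$, $\alpha$, $w_0\in\mathcal W$, set $A_0=0$, $z_0=w_0$, $g_0=0$. For $k=1,\dots,K$: - $a_k=\frac{\alpha\gamma(1+\sigma A_{k-1})}{L}$, $A_k=A_{k-1}+a_k$; - $w_k=P_{z_{k-1}}\big(\frac{\alpha}{L}F(w_{k-1})\big)$; - $g_k=g_{k-1}+a_k\big(F(w_k)-\frac\sigma\gamma\nabla\phi(w_k-w_0)\big)$; - $z_k=P_{w_0}\big(\frac1{1+\sigma A_k}g_k\big)$.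 The output is $\tilde w_K=w_{\tilde k}$ where $\tilde k\in\{1,\dots,K\}$ minimizes $\|w_k-z_{k-1}\|+\|w_{k-1}-z_{k-1}\|$ over $k\in\{1,\dots,K\}$. *)

(* Defs.v *)
From HB Require Import structures.
From mathcomp Require Import all_boot all_order all_algebra.
From mathcomp Require Import all_classical all_reals all_analysis.

Set Implicit Arguments.
Unset Strict Implicit.
Unset Printing Implicit Defensive.
Import Order.TTheory GRing.Theory Num.Theory numFieldNormedType.Exports.
Local Open Scope classical_set_scope.
Local Open Scope ring_scope.

(* The library's own norm on ['rV[R]_d] is the sup norm; it only enters through
   its topology (closedness, differentiability), which is the same for every
   norm on R^d. The norm of the problem is an explicit function [N]. *)

Section OptDE.
Context {R : realType} {d : nat}.
Implicit Types (N : 'rV[R]_d -> R) (W : set 'rV[R]_d) (F : 'rV[R]_d -> 'rV[R]_d).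
Implicit Types (x y v w z : 'rV[R]_d).

(* Nonnegativity and [N 0 = 0] follow from the three axioms. *)
Definition is_norm N : Prop :=
  [/\ forall x y, N (x + y) <= N x + N y,
      forall (a : R) x, N (a *: x) = `|a| * N x
    & forall x, N x = 0 -> x = 0].

Definition dotp x y : R := \sum_(i < d) x 0 i * y 0 i.

(* The set is nonempty and bounded when [N] is a norm, so the real-valued [sup]
   is the actual supremum, which is attained. *)
Definition dual_norm N y : R := sup [set dotp x y | x in [set x | N x <= 1]].

Definition phi N : 'rV[R]_d -> R^o := fun x => 2^-1 * N x ^+ 2.

Definition gradient (f : 'rV[R]_d -> R^o) v : 'rV[R]_d :=
  \row_(i < d) 'D_(delta_mx 0 i) f v.

Definition norm_assumption N (gamma delta : R) : Prop :=
  [/\ forall v, differentiable (phi N) v,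
      forall w v, phi N w >=
        phi N v + dotp (gradient (phi N) v) (w - v)
        + gamma / 2 * N (w - v) ^+ 2
    & forall w, dual_norm N (gradient (phi N) w) <= delta * N w].

Definition bregman N v w : R :=
  phi N w - phi N v - dotp (gradient (phi N) v) (w - v).

Definition lipschitz_operator N W F (L : R) : Prop :=
  forall w v, W w -> W v -> dual_norm N (F w - F v) <= L * N (w - v).

Definition weak_solution W F wstar : Prop :=
  W wstar /\ forall w, W w -> 0 <= dotp (F w) (w - wstar).

Definition sigma_weak_solution N W F (gamma sigma : R) w0 wstar : Prop :=
  W wstar /\ forall w, W w ->
    sigma / gamma * (bregman N (w - w0) (wstar - w0)
                     + bregman N (wstar - w0) (w - w0))
    <= dotp (F w) (w - wstar).

Definition argmin W (f : 'rV[R]_d -> R) : set 'rV[R]_d :=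
  [set z | W z /\ forall y, W y -> f z <= f y].

(* The minimizer exists and is unique when [W] is nonempty, closed and convex
   and [N] satisfies the norm assumption with [0 < gamma]; [xget] selects it,
   and its default value [v] is then irrelevant. *)
Definition prox N W (gamma : R) v w : 'rV[R]_d :=
  xget v (argmin W (fun z => dotp w z + (2 * gamma)^-1 * N (z - v) ^+ 2)).

Fixpoint optDE_A (L gamma sigma alpha : R) (k : nat) : R :=
  if k is k'.+1 then
    let A := optDE_A L gamma sigma alpha k' in
    A + alpha * gamma * (1 + sigma * A) / L
  else 0.

(* The step a_k, meaningful for k >= 1. *)
Definition optDE_a (L gamma sigma alpha : R) (k : nat) : R :=
  alpha * gamma * (1 + sigma * optDE_A L gamma sigma alpha k.-1) / L.

(* The triple (w_k, g_k, z_k). *)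
Fixpoint optDE_state N W F (L gamma sigma alpha : R) w0 (k : nat)
    : 'rV[R]_d * 'rV[R]_d * 'rV[R]_d :=
  if k is k'.+1 then
    let: (w, g, z) := optDE_state N W F L gamma sigma alpha w0 k' in
    let w' := prox N W gamma z ((alpha / L) *: F w) in
    let g' := g + optDE_a L gamma sigma alpha k *:
      (F w' - (sigma / gamma) *: gradient (phi N) (w' - w0)) in
    let z' := prox N W gamma w0
      ((1 + sigma * optDE_A L gamma sigma alpha k)^-1 *: g') in
    (w', g', z')
  else (w0, 0, w0).

Definition optDE_w N W F (L gamma sigma alpha : R) w0 (k : nat) : 'rV[R]_d :=
  (optDE_state N W F L gamma sigma alpha w0 k).1.1.

Definition optDE_z N W F (L gamma sigma alpha : R) w0 (k : nat) : 'rV[R]_d :=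
  (optDE_state N W F L gamma sigma alpha w0 k).2.

Definition optDE_residual N W F (L gamma sigma alpha : R) w0 (k : nat) : R :=
  let w := optDE_w N W F L gamma sigma alpha w0 in
  let z := optDE_z N W F L gamma sigma alpha w0 in
  N (w k - z k.-1) + N (w k.-1 - z k.-1).

(* A predicate rather than a function: ties between minimizing indices may be
   broken arbitrarily. *)
Definition optDE_output N W F (L gamma sigma alpha : R) w0 (K : nat)
    (wtilde : 'rV[R]_d) : Prop :=
  exists ktilde : nat,
    [/\ (1 <= ktilde <= K)%N,
        forall k : nat, (1 <= k <= K)%N ->
          optDE_residual N W F L gamma sigma alpha w0 ktilde
          <= optDE_residual N W F L gamma sigma alpha w0 k
      & wtilde = optDE_w N W F L gamma sigma alpha w0 ktilde].

End OptDE.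

(* Main.v *)
Require Import Defs.
From HB Require Import structures.
From mathcomp Require Import all_boot all_order all_algebra.
From mathcomp Require Import all_classical all_reals all_analysis.
From mathcomp Require Import ring lra.
Set Implicit Arguments.
Unset Strict Implicit.
Unset Printing Implicit Defensive.
Import Order.TTheory GRing.Theory Num.Theory numFieldNormedType.Exports.
Local Open Scope classical_set_scope.
Local Open Scope ring_scope.

(** The proof tracks the estimate functions
    [E_k y = phi (y - w0) / gamma + \sum_(i <= k) a_i *
      (<F w_i, y - w_i> + sigma / gamma * V_(w_i - w0) (y - w0))].
    Expanding the Bregman terms shows that [E_k] is, up to a constant, the
    objective whose minimizer over [W] is the dual iterate [z_k]
    ([estimate_shape]), so it grows quadratically away from [z_k], with modulus
    [S_k = 1 + sigma * A_k] ([estimate_strong_min]).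

    Evaluated at a solution [wstar], every summand is nonpositive, by the
    definition of a (sigma-)weak solution; hence
    [E_k z_k <= E_k wstar <= N (wstar - w0) ^+ 2 / (2 * gamma)]
    ([estimate_le_at_solution]).

    In the other direction, [E_k z_k] increases by at least a fixed multiple of
    [S_(k-1) * res_k ^+ 2] per iteration, where
    [res_k = N (w_k - z_(k-1)) + N (w_(k-1) - z_(k-1))] is the quantity that the
    output minimizes ([potential_lower_bound]). The increase combines the
    quadratic growth of [E_(k-1)] around [z_(k-1)], the three-point inequality
    for the extrapolation step defining [w_k], and the Lipschitz bound on the
    optimistic error [F w_k - F w_(k-1)]; Young's inequality and
    [alpha ^+ 2 <= 1 / 32] absorb that error ([descent_inequality]). The part of
    it that involves [N (w_(k-1) - z_(k-1))] is paid for by the term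
    [gamma / 4 * S_(k-1) * N (w_(k-1) - z_(k-1)) ^+ 2] kept from the previous
    iteration.
    As the weights [S_i] sum to [A_K * L / (alpha * gamma)], the smallest
    residual is of order [N (w0 - wstar) / sqrt (L * A_K)] ([residual_bound]).

    Finally the first-order optimality condition of the step defining [w_k] and
    the Lipschitz bound give
    [<F w_k, w_k - y> <= (1 + delta / (alpha * gamma)) * L * res_k * N (w_k - y)]
    ([optDE_gap]). This is the gap bound; the bound on the distance to [wstar]
    follows by taking [y = wstar], where strong monotonicity bounds the left-hand
    side below by [sigma * N (w_k - wstar) ^+ 2]. *)

(** * The Euclidean pairing and the gradient *)

Section DotProduct.
Context {R : realType} {d : nat}.
Implicit Types (x y z : 'rV[R]_d) (a : R).

Lemma dotpC x y : dotp x y = dotp y x.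
Proof. by apply: eq_bigr => i _; rewrite mulrC. Qed.

Lemma dotpDr x y z : dotp x (y + z) = dotp x y + dotp x z.
Proof. by rewrite -big_split; apply: eq_bigr => i _; rewrite mxE mulrDr. Qed.

Lemma dotpZr a x y : dotp x (a *: y) = a * dotp x y.
Proof. by rewrite mulr_sumr; apply: eq_bigr => i _; rewrite mxE mulrCA. Qed.

Lemma dotpNr x y : dotp x (- y) = - dotp x y.
Proof. by rewrite -scaleN1r dotpZr mulN1r. Qed.

Lemma dotpBr x y z : dotp x (y - z) = dotp x y - dotp x z.
Proof. by rewrite dotpDr dotpNr. Qed.

Lemma dotpDl x y z : dotp (x + y) z = dotp x z + dotp y z.
Proof. by rewrite dotpC dotpDr !(dotpC z). Qed.

Lemma dotpZl a x y : dotp (a *: x) y = a * dotp x y.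
Proof. by rewrite dotpC dotpZr dotpC. Qed.

Lemma dotpBl x y z : dotp (x - y) z = dotp x z - dotp y z.
Proof. by rewrite dotpC dotpBr !(dotpC z). Qed.

Lemma dotp0l x : dotp 0 x = 0.
Proof. by rewrite -(scale0r 0) dotpZl mul0r. Qed.

Lemma dotp_continuous x : continuous (dotp x : 'rV[R]_d -> R).
Proof.
move=> y; rewrite /dotp /continuous_at.
apply: (@cvg_big R^o _ _ _ _ (@add_continuous R^o)) => [|i _].
  exact: (nbhs_filter y).
exact: (cvgM (cvg_cst _) (@coord_continuous R _ _ 0 i y)).
Qed.

(** Hölder's inequality for the exponents 1 and infinity: the norm of [y] is the
    sup norm. *)
Lemma dotp_le_sup_norm x y : dotp x y <= (\sum_(i < d) `|x 0 i|) * `|y|.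
Proof.
rewrite mulr_suml; apply: ler_sum => i _.
apply: le_trans (ler_norm _) _; rewrite normrM ler_wpM2l //.
rewrite [leRHS]/Num.Def.normr /= mx_normrE.
exact: (le_bigmax _ (fun ij : 'I_1 * 'I_d => `|y ij.1 ij.2|) (0, i)).
Qed.

Lemma derive_gradient (f : 'rV[R]_d -> R^o) x y :
  differentiable f x -> 'D_y f x = dotp (gradient f x) y.
Proof.
move=> fx; rewrite deriveE // [in LHS](row_sum_delta y) linear_sum.
by apply: eq_bigr => i _; rewrite linearZ mxE deriveE // mulrC.
Qed.

End DotProduct.

(** * Norms on R^d *)

Section Norm.
Context {R : realType} {d : nat} (N : 'rV[R]_d -> R) (N_norm : is_norm N).
Implicit Types x y z u v : 'rV[R]_d.

Lemma is_normZ a x : N (a *: x) = `|a| * N x.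
Proof. by case: N_norm. Qed.

Lemma is_norm0 : N 0 = 0.
Proof. by rewrite -(scale0r 0) is_normZ normr0 mul0r. Qed.

Lemma is_normN x : N (- x) = N x.
Proof. by rewrite -scaleN1r is_normZ normrN1 mul1r. Qed.

Lemma is_norm_ge0 x : 0 <= N x.
Proof.
have [tri _ _] := N_norm.
by have := tri x (- x); rewrite subrr is_norm0 is_normN -mulr2n pmulrn_lge0.
Qed.

Lemma is_normC x y : N (x - y) = N (y - x).
Proof. by rewrite -is_normN opprB. Qed.

Lemma is_norm_triangle x y z : N (x - z) <= N (x - y) + N (y - z).
Proof. by have [tri _ _] := N_norm; rewrite -(subrKA y x). Qed.

Lemma phi0 : phi N 0 = 0.
Proof. by rewrite /phi is_norm0 expr0n mulr0. Qed.

Context (phi_continuous : continuous (phi N)).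

(** On the unit sphere of the sup norm, which is compact, the continuous function
    [phi N] attains a positive minimum; homogeneity spreads the bound to the
    whole space. *)
Lemma norm_ge_sup_norm : exists2 c : R, 0 < c & forall x, c * `|x| <= N x.
Proof.
pose S := [set x : 'rV[R]_d | `|x| = 1].
have [S0|/set0P S0] := eqVneq S set0.
  (* the sphere is empty exactly when d = 0, and then 0 is the only point *)
  exists 1 => // x; have [->|x0] := eqVneq x 0.
    by rewrite normr0 mulr0 is_norm_ge0.
  have : S (`|x|^-1 *: x).
    by rewrite /S /= normrZ normfV normr_id mulVf ?normr_eq0.
  by rewrite S0.
have Scompact : compact S.
  apply: bounded_closed_compact.
    by exists 1; split; [exact: num_real | move=> M M1 x /= ->; exact: ltW].
  apply: (@closed_comp _ _ (fun x : 'rV[R]_d => `|x|) [set 1]);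
    last exact: closed_eq.
  by move=> x _; exact: norm_continuous.
have [|x0 Sx0 x0min] := EVT_min_rV S0 Scompact (f := phi N).
  exact: continuous_subspaceT.
rewrite inE /= in Sx0.
have Nx0 : 0 < N x0.
  rewrite lt_neqAle is_norm_ge0 andbT eq_sym; apply/eqP => Nx0.
  have [_ _ def] := N_norm.
  by move: Sx0; rewrite (def _ Nx0) /S /= normr0 => /eqP; rewrite eq_sym oner_eq0.
exists (N x0) => // x; have [->|x1] := eqVneq x 0.
  by rewrite normr0 mulr0 is_norm_ge0.
have := x0min (`|x|^-1 *: x).
rewrite inE /S /= normrZ normfV normr_id mulVf ?normr_eq0 //.
move=> /(_ erefl); rewrite /phi ler_pM2l ?invr_gt0 //.
rewrite (@ler_pXn2r _ 2) ?nnegrE ?is_norm_ge0 // is_normZ normfV normr_id.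
by rewrite ler_pdivlMl ?normr_gt0 // mulrC.
Qed.

(** The supremum defining the dual norm is over a bounded set because [N]
    dominates the sup norm; without that [sup] would default to 0. *)
Lemma dotp_le_dual_norm x y : dotp y x <= dual_norm N y * N x.
Proof.
have [c c0 cN] := norm_ge_sup_norm.
pose B := (\sum_(i < d) `|y 0 i|) / c.
have yB u : dotp y u <= B * N u.
  apply: le_trans (dotp_le_sup_norm _ _) _; rewrite /B -mulrA.
  by apply: ler_wpM2l; [exact: sumr_ge0 | rewrite ler_pdivlMl].
have [x0|x0] := eqVneq x 0.
  by rewrite x0 is_norm0 mulr0 dotpC dotp0l.
have Nx : 0 < N x.
  by rewrite (lt_le_trans _ (cN x)) // mulr_gt0 // normr_gt0.
rewrite -ler_pdivrMr // mulrC -dotpZr dotpC; apply: ub_le_sup.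
  exists `|B| => _ [u Nu <-]; rewrite dotpC; apply: le_trans (yB u) _.
  apply: le_trans (ler_norm _) _; rewrite normrM ler_piMr //.
  by rewrite ger0_norm ?is_norm_ge0.
exists ((N x)^-1 *: x) => //=.
by rewrite is_normZ gtr0_norm ?invr_gt0 // mulVf ?gt_eqF.
Qed.

Lemma prox_objectiveE gamma u v z :
  dotp u z + (2 * gamma)^-1 * N (z - v) ^+ 2 =
  dotp u z + gamma^-1 * phi N (z - v).
Proof. by rewrite /phi invfM mulrA (mulrC 2^-1). Qed.

End Norm.

(** * The prox-mapping *)

Section Prox.
Context {R : realType} {d : nat} (N : 'rV[R]_d -> R) (W : set 'rV[R]_d).
Context (gamma delta : R).
Context (N_norm : is_norm N) (N_assum : norm_assumption N gamma delta).
Context (gamma_gt0 : 0 < gamma) (W_nonempty : W !=set0) (W_closed : closed W).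
Context (W_convex : convex_set (W : set (convex_lmodType 'rV[R]_d))).
Implicit Types x y z u v : 'rV[R]_d.

Lemma phi_continuous : continuous (phi N).
Proof. by case: N_assum => df _ _ x; exact: differentiable_continuous. Qed.

(** The objective is coercive: its quadratic part dominates the linear part,
    which is at most [dual_norm N u] times the distance to [v]. Hence it suffices
    to minimize over a compact sublevel set. *)
Lemma argmin_prox_nonempty v u :
  argmin W (fun z => dotp u z + (2 * gamma)^-1 * N (z - v) ^+ 2) !=set0.
Proof.
have [y Wy] := W_nonempty; pose f z := dotp u z + gamma^-1 * phi N (z - v).
have fE z : dotp u z + (2 * gamma)^-1 * N (z - v) ^+ 2 = f z.
  by rewrite prox_objectiveE.
have f_continuous : continuous f.
  move=> z; have phi_z : phi N (x - v) @[x --> z] --> phi N (z - v).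
    apply: (@continuous_comp _ _ _ (fun z => z - v) (phi N));
      last exact: phi_continuous.
    exact: (cvgB cvg_id (cvg_cst v)).
  have gphi_z := cvgM (cvg_cst gamma^-1) phi_z.
  have dotp_z : dotp u x @[x --> z] --> dotp u z by exact: dotp_continuous.
  have := cvgD dotp_z (gphi_z _ _); exact.
have [c c0 cN] := norm_ge_sup_norm N_norm phi_continuous.
(* beyond the distance r from v, the objective exceeds its value at y *)
pose r := 1 + 2 * gamma * (`|dual_norm N u| + `|f y - dotp u v|).
pose S := W `&` [set z | f z <= f y].
have S_bound z : S z -> N (z - v) <= r.
  move=> [_ /= fz]; rewrite leNgt; apply/negP => rn.
  have := dotp_le_dual_norm N_norm phi_continuous (v - z) u.
  rewrite (is_normC N_norm v z) dotpBr => uvz.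
  have n0 := is_norm_ge0 N_norm (z - v).
  move: fz; rewrite -fE => fz.
  have n1 : 1 < N (z - v).
    apply: le_lt_trans rn; rewrite /r lerDl.
    by rewrite mulr_ge0 ?addr_ge0 // mulr_ge0 // ltW.
  set n := N (z - v) in n0 n1 fz uvz rn.
  have fz' : n ^+ 2 <= 2 * gamma * (f y - dotp u z).
    by rewrite -ler_pdivrMl ?mulr_gt0 // lerBrDl.
  have := ler_norm (dual_norm N u); have := ler_norm (f y - dotp u v).
  move: rn; rewrite /r; set m := `|_ - _|; set b := `|dual_norm _ _| => rn mM bB.
  have m0 : 0 <= m by exact: normr_ge0.
  have b0 : 0 <= b by exact: normr_ge0.
  have bn : dual_norm N u * n <= b * n by rewrite ler_wpM2r.
  have uz : f y - dotp u z <= m + b * n by lra.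
  have mn : m <= m * n by rewrite ler_peMr // ltW.
  have scaled : 2 * gamma * (f y - dotp u z) <= 2 * gamma * ((b + m) * n).
    by rewrite ler_pM2l ?mulr_gt0 //; lra.
  have rn_n : (1 + 2 * gamma * (b + m)) * n < n ^+ 2.
    by rewrite expr2 ltr_pM2r // (lt_trans _ n1).
  lra.
have S_compact : compact S.
  apply: bounded_closed_compact.
    exists (`|v| + r / c); split=> [|M rM z Sz]; first exact: num_real.
    apply: ltW; apply: le_lt_trans rM; rewrite -{1}(subrK v z) addrC.
    apply: le_trans (ler_normD _ _) _; rewrite lerD2l.
    by rewrite ler_pdivlMr // mulrC (le_trans (cN _)) // S_bound.
  apply: closedI => //.
  apply: (@closed_comp _ _ f [set t | t <= f y]); last exact: closed_le.
  by move=> z _; exact: f_continuous.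
have Sy : S y by split=> /=.
have [|z Sz z_min] := EVT_min_rV (ex_intro _ y Sy) S_compact (f := f).
  exact: continuous_subspaceT.
rewrite inE in Sz; exists z; split=> [|x Wx]; first by case: Sz.
rewrite !fE; have [fxy|/ltW fyx] := leP (f x) (f y).
  by apply: z_min; rewrite inE.
by case: Sz => _ /= /le_trans; exact.
Qed.

Lemma segment_in x y t : W x -> W y -> 0 <= t <= 1 -> W (x + t *: (y - x)).
Proof.
move=> Wx Wy /andP[t0 t1].
have := W_convex (Itv01 t0 t1) (mem_set Wy) (mem_set Wx).
rewrite inE.
suff -> : conv (Itv01 t0 t1) (y : convex_lmodType 'rV[R]_d) x
    = x + t *: (y - x) by [].
by rewrite [LHS]/(t *: y + (1 - t) *: x) scalerBl scale1r scalerBr addrCA.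
Qed.

Lemma prox_argmin v u : argmin W
  (fun z => dotp u z + (2 * gamma)^-1 * N (z - v) ^+ 2) (prox N W gamma v u).
Proof.
rewrite /prox; case: xgetP => // none.
by have [z /none] := argmin_prox_nonempty v u.
Qed.

Lemma prox_in v u : W (prox N W gamma v u).
Proof. by have [] := prox_argmin v u. Qed.

(** The first-order optimality condition: the one-sided derivative of the
    objective at its minimizer, along a segment that stays in [W], is
    nonnegative. *)
Lemma prox_variational v u y : W y ->
  0 <= dotp u (y - prox N W gamma v u)
       + gamma^-1 * dotp (gradient (phi N) (prox N W gamma v u - v))
                         (y - prox N W gamma v u).
Proof.
have [] := prox_argmin v u; move: (prox _ _ _ _ _) => p Wp p_min Wy.
have [df _ _] := N_assum.
suff opt : - (gamma * dotp u (y - p)) <= dotp (gradient (phi N) (p - v)) (y - p).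
  rewrite -(pmulr_rge0 _ gamma_gt0) mulrDr mulrA mulfV ?gt_eqF // mul1r.
  by rewrite -lerBlDl sub0r.
have dphi := diff_derivable (v := y - p) (df (p - v)).
rewrite -derive_gradient //; apply: (cvgr_to_ge (cvg_dnbhs_at_right dphi)).
near=> t.
have t0 : 0 < t by near: t; exact: nbhs_right_gt.
have t1 : t < 1 by near: t; exact: nbhs_right_lt.
have t01 : 0 <= t <= 1 by rewrite !ltW.
have := p_min _ (segment_in Wp Wy t01).
rewrite !prox_objectiveE dotpDr dotpZr -addrA lerD2l => pt.
suff : - (gamma * dotp u (y - p))
    <= t^-1 * (phi N (t *: (y - p) + (p - v)) - phi N (p - v)) by [].
rewrite ler_pdivlMl // (_ : t *: (y - p) + (p - v) = p + t *: (y - p) - v);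
  last by rewrite addrC addrAC.
move: pt; rewrite -(ler_pM2l gamma_gt0) mulrDr !mulVKf ?gt_eqF //.
lra.
Unshelve. all: by end_near.
Qed.

(** The minimizer of a function that is strongly convex with modulus 1 is a point
    of quadratic growth: the strong convexity inequality of [phi] at the
    minimizer, whose linear term the optimality condition makes nonnegative. *)
Lemma prox_three_point v u y : W y ->
  dotp u (prox N W gamma v u) + gamma^-1 * phi N (prox N W gamma v u - v)
    + 2^-1 * N (y - prox N W gamma v u) ^+ 2
  <= dotp u y + gamma^-1 * phi N (y - v).
Proof.
move=> Wy; have := prox_variational v u Wy; set p := prox _ _ _ _ _ => opt.
have [_ /(_ (y - v) (p - v)) sc _] := N_assum.
rewrite opprB addrA subrK in sc.
have : gamma^-1 * (phi N (p - v) + dotp (gradient (phi N) (p - v)) (y - p)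
    + gamma / 2 * N (y - p) ^+ 2) <= gamma^-1 * phi N (y - v).
  by rewrite ler_pM2l ?invr_gt0.
rewrite !mulrDr !mulrA mulVf ?gt_eqF // mul1r.
by move: opt; rewrite dotpBr; lra.
Qed.

End Prox.

(** * Potential analysis of the algorithm *)

(** The real inequality behind one iteration, for [p = N (w_k - z_k)],
    [q = N (w_k - z_(k-1))], [r = N (w_(k-1) - z_(k-1))], [e = N (w_k - w_(k-1))]
    and [1 + c] the growth factor [S_k / S_(k-1)] of the weights. The product
    [alpha * e * p] is split by Young's inequality; the term in [c * p ^+ 2] on
    the right, which comes from the Bregman term of the estimate function, makes
    up for the growth of the weights. *)
Lemma descent_inequality (R : realFieldType) (gamma alpha c p q r e : R) :
  0 < gamma -> gamma <= 1 -> 0 < alpha -> alpha ^+ 2 <= 32^-1 -> 0 <= c ->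
  0 <= p -> e <= q + r ->
  gamma / 16 * (q + r) ^+ 2 + gamma / 4 * (1 + c) * p ^+ 2
  <= gamma / 4 * r ^+ 2 + (gamma / 2 * p ^+ 2 + 2^-1 * q ^+ 2
     - alpha * gamma * (e * p)) + c / 2 * p ^+ 2.
Proof.
move=> g0 g1 a0 a2 c0 p0 eqr.
have ep : alpha * (e * p) <= alpha * ((q + r) * p).
  by rewrite ler_pM2l // ler_wpM2r.
have young : alpha * ((q + r) * p) <= p ^+ 2 / 4 + alpha ^+ 2 * (q + r) ^+ 2.
  by have := sqr_ge0 (p / 2 - alpha * (q + r)); lra.
have asq : alpha ^+ 2 * (q + r) ^+ 2 <= 32^-1 * (q + r) ^+ 2.
  by rewrite ler_wpM2r ?sqr_ge0.
have cross : (q + r) ^+ 2 <= 2 * (q ^+ 2 + r ^+ 2).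
  by have := sqr_ge0 (q - r); lra.
have gbound : gamma * (alpha * (e * p)) <=
    gamma * (p ^+ 2 / 4 + 16^-1 * (q ^+ 2 + r ^+ 2)).
  by rewrite ler_pM2l //; lra.
have gcross : gamma * (q + r) ^+ 2 <= gamma * (2 * (q ^+ 2 + r ^+ 2)).
  by rewrite ler_pM2l.
have gq : gamma * q ^+ 2 <= q ^+ 2 by rewrite ler_piMl ?sqr_ge0.
have gr : 0 <= gamma * r ^+ 2 by rewrite mulr_ge0 ?sqr_ge0 // ltW.
have cp : 0 <= c * p ^+ 2 by rewrite mulr_ge0 ?sqr_ge0.
have gcp : gamma * (c * p ^+ 2) <= c * p ^+ 2 by rewrite ler_piMl.
have q2 := sqr_ge0 q.
lra.
Qed.

Section OptDE_analysis.
Context {R : realType} {d : nat} (W : set 'rV[R]_d) (N : 'rV[R]_d -> R).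
Context (F : 'rV[R]_d -> 'rV[R]_d) (L gamma delta sigma alpha : R).
Context (w0 : 'rV[R]_d) (W_closed : closed W).
Context (W_convex : convex_set (W : set (convex_lmodType 'rV[R]_d))).
Context (N_norm : is_norm N) (gamma_gt0 : 0 < gamma) (gamma_le1 : gamma <= 1).
Context (N_assum : norm_assumption N gamma delta).
Context (L_gt0 : 0 < L) (F_lip : lipschitz_operator N W F L) (w0_in : W w0).
Context (delta_gt0 : 0 < delta) (sigma_ge0 : 0 <= sigma) (alpha_gt0 : 0 < alpha).
Implicit Types (x y z u v : 'rV[R]_d) (k : nat).

Local Notation A := (optDE_A L gamma sigma alpha).
Local Notation a := (optDE_a L gamma sigma alpha).
Local Notation w := (optDE_w N W F L gamma sigma alpha w0).
Local Notation z := (optDE_z N W F L gamma sigma alpha w0).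
Local Notation g k := (optDE_state N W F L gamma sigma alpha w0 k).1.2.
Local Notation res := (optDE_residual N W F L gamma sigma alpha w0).
Local Notation weight k := (1 + sigma * A k).

Let W_nonempty : W !=set0. Proof. by exists w0. Qed.

Let three_point := prox_three_point N_norm N_assum gamma_gt0
  W_nonempty W_closed W_convex.

Let variational := prox_variational N_norm N_assum gamma_gt0
  W_nonempty W_closed W_convex.

Lemma optDE_wS k : w k.+1 = prox N W gamma (z k) ((alpha / L) *: F (w k)).
Proof. by rewrite /optDE_w /optDE_z /=; case: optDE_state => [[]]. Qed.

Lemma optDE_gS k : g k.+1 = g k + a k.+1 *:
  (F (w k.+1) - (sigma / gamma) *: gradient (phi N) (w k.+1 - w0)).
Proof. by rewrite /optDE_w /=; case: optDE_state => [[]]. Qed.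

Lemma optDE_zS k : z k.+1 = prox N W gamma w0 ((weight k.+1)^-1 *: g k.+1).
Proof. by rewrite /optDE_z /=; case: optDE_state => [[]]. Qed.

Lemma optDE_AS k : A k.+1 = A k + a k.+1.
Proof. by []. Qed.

Lemma optDE_aS k : a k.+1 = alpha * gamma / L * weight k.
Proof. by rewrite /optDE_a /= mulrAC. Qed.

Lemma optDE_A_ge0 k : 0 <= A k.
Proof.
elim: k => // k IH; rewrite optDE_AS optDE_aS addr_ge0 // mulr_ge0 //.
  by rewrite ltW // divr_gt0 // mulr_gt0.
by rewrite addr_ge0 // mulr_ge0.
Qed.

Lemma weight_ge1 k : 1 <= weight k.
Proof. by rewrite lerDl mulr_ge0 // optDE_A_ge0. Qed.

Lemma weight_gt0 k : 0 < weight k.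
Proof. by rewrite (lt_le_trans ltr01) // weight_ge1. Qed.

Lemma optDE_a_gt0 k : 0 < a k.+1.
Proof. by rewrite optDE_aS mulr_gt0 ?weight_gt0 // divr_gt0 // mulr_gt0. Qed.

Lemma weightS k : weight k.+1 = weight k * (1 + alpha * gamma * sigma / L).
Proof. by rewrite optDE_AS optDE_aS; ring. Qed.

Lemma optDE_w_in k : W (w k).
Proof. by case: k => // k; rewrite optDE_wS; exact: (prox_in N_norm N_assum). Qed.

Lemma optDE_z_in k : W (z k).
Proof. by case: k => // k; rewrite optDE_zS; exact: (prox_in N_norm N_assum). Qed.

Lemma sum_weight k : alpha * gamma / L * \sum_(i < k) weight i = A k.
Proof.
elim: k => [|k IH]; first by rewrite big_ord0 mulr0.
by rewrite big_ord_recr mulrDr IH optDE_AS optDE_aS.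
Qed.

Lemma optDE_A_closed_form k :
  sigma * A k = (1 + alpha * gamma * sigma / L) ^+ k - 1.
Proof.
have -> : (1 + alpha * gamma * sigma / L) ^+ k = weight k.
  by elim: k => [|k IH]; [rewrite /= mulr0 addr0 | rewrite exprSr IH weightS].
by rewrite addrC addKr.
Qed.

Lemma optDE_A_add_a1 k : A k + a 1 <= A k.+1.
Proof.
rewrite optDE_AS lerD2l !optDE_aS ler_pM2l ?divr_gt0 ?mulr_gt0 //.
by rewrite /= mulr0 addr0 weight_ge1.
Qed.

Fixpoint estimate k y : R :=
  if k is k'.+1 then
    estimate k' y + a k * (dotp (F (w k)) (y - w k)
      + sigma / gamma * bregman N (w k - w0) (y - w0))
  else gamma^-1 * phi N (y - w0).

(** The quadratic parts of the Bregman terms add up to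
    [sigma * A_k / gamma * phi N (y - w0)], and their linear parts are the
    gradient corrections accumulated in [g_k]. *)
Lemma estimate_shape k : exists c, forall y,
  estimate k y = dotp (g k) y + weight k / gamma * phi N (y - w0) + c.
Proof.
elim: k => [|k [c IH]].
  by exists 0 => y; rewrite /= dotp0l mulr0 !addr0 add0r div1r.
exists (c - a k.+1 * (dotp (F (w k.+1)) (w k.+1) + sigma / gamma *
  (phi N (w k.+1 - w0) - dotp (gradient (phi N) (w k.+1 - w0)) (w k.+1)))) => y.
rewrite [LHS]/= IH optDE_gS optDE_AS /bregman opprB subrKA.
rewrite dotpDl dotpZl dotpBl dotpZl !dotpBr.
by ring.
Qed.

(** [z_k] minimizes [estimate k], which is the weight times a prox objective up to
    a constant; the modulus is therefore the weight. *)
Lemma estimate_strong_min k y : W y ->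
  estimate k (z k) + weight k / 2 * N (y - z k) ^+ 2 <= estimate k y.
Proof.
move=> Wy; case: k => [|k].
  (* z_0 = w0 is not computed by a prox step; here the growth is phi's own *)
  rewrite /= [z 0]/= subrr phi0 // !mulr0 addr0 add0r div1r.
  rewrite /phi mulrA ler_wpM2r ?sqr_ge0 //.
  by rewrite -[leLHS]mul1r ler_pM2r ?invr_gt0 // invf_ge1.
have [c estE] := estimate_shape k.+1.
have := three_point w0 ((weight k.+1)^-1 *: g k.+1) Wy.
rewrite -optDE_zS !estE !dotpZl.
move: (weight_gt0 k.+1); move: (weight k.+1) => S S_gt0.
rewrite -(ler_pM2l S_gt0) !mulrDr !mulVKf ?(lt0r_neq0 S_gt0) // !mulrA.
lra.
Qed.

Lemma bregman_ge u v : gamma / 2 * N (v - u) ^+ 2 <= bregman N u v.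
Proof. by case: N_assum => _ /(_ v u) + _; rewrite /bregman; lra. Qed.

Lemma bregman_ge0 u v : 0 <= bregman N u v.
Proof.
apply: le_trans (bregman_ge u v); rewrite mulr_ge0 ?sqr_ge0 //.
by rewrite divr_ge0 // ltW.
Qed.

(** Each new term is nonpositive at a solution: the [bregman] term with base
    point [w_i - w0] is cancelled by the one in the definition of the solution,
    and the other one there is nonnegative. *)
Lemma estimate_le_at_solution wstar k :
  sigma_weak_solution N W F gamma sigma w0 wstar ->
  estimate k wstar <= gamma^-1 * phi N (wstar - w0).
Proof.
move=> [Wstar sol]; elim: k => //= k IH; rewrite -[leRHS]addr0 lerD //.
have := sol _ (optDE_w_in k.+1); rewrite -(opprB wstar) dotpNr mulrDr.
have b0 : 0 <= sigma / gamma * bregman N (wstar - w0) (w k.+1 - w0).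
  by rewrite mulr_ge0 ?divr_ge0 ?(ltW gamma_gt0) ?bregman_ge0.
rewrite pmulr_rle0 ?optDE_a_gt0 //; lra.
Qed.

Lemma lipschitz_dotp x y u : W x -> W y ->
  dotp (F x - F y) u <= L * N (x - y) * N u.
Proof.
move=> Wx Wy; apply: le_trans
  (dotp_le_dual_norm N_norm (phi_continuous N_assum) _ _) _.
by rewrite ler_wpM2r ?is_norm_ge0 // F_lip.
Qed.

Context (alpha_small : alpha ^+ 2 <= 32^-1).

(** The second term is the reserve that the next iteration spends on the part of
    its optimistic error coming from [N (w_k - z_k)]. *)
Lemma potential_lower_bound k :
  gamma / 16 * (\sum_(i < k) weight i * res i.+1 ^+ 2)
    + gamma / 4 * weight k * N (w k - z k) ^+ 2 <= estimate k (z k).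
Proof.
elim: k => [|k IH].
  rewrite big_ord0 mulr0 add0r [z 0]/= [w 0]/= subrr is_norm0 // expr0n !mulr0.
  by rewrite /= subrr phi0 // mulr0.
rewrite big_ord_recr [estimate _ _]/= mulrDr.
have zmin := estimate_strong_min k (optDE_z_in k.+1).
have breg := bregman_ge (w k.+1 - w0) (z k.+1 - w0).
rewrite opprB subrKA in breg.
have := three_point (z k) ((alpha / L) *: F (w k)) (optDE_z_in k.+1).
rewrite -optDE_wS !dotpZl /phi => opt.
have lip := lipschitz_dotp (w k.+1 - z k.+1) (optDE_w_in k.+1) (optDE_w_in k).
have tri := is_norm_triangle N_norm (w k.+1) (z k) (w k).
rewrite (is_normC N_norm (z k)) in tri.
have p0 := is_norm_ge0 N_norm (w k.+1 - z k.+1).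
have c0 : 0 <= alpha * gamma * sigma / L.
  by rewrite divr_ge0 ?mulr_ge0 // ltW.
have := descent_inequality gamma_gt0 gamma_le1 alpha_gt0 alpha_small c0 p0 tri.
have -> : res k.+1 = N (w k.+1 - z k) + N (w k - z k) by [].
rewrite weightS optDE_aS.
rewrite !(is_normC N_norm (z k.+1)) in zmin breg opt *.
rewrite !(dotpBl, dotpBr) in lip *.
move: IH zmin breg opt lip (weight_gt0 k).
(* What remains is linear in these quantities, once the Lipschitz bound is
   multiplied by alpha / L, the three-point inequality by gamma, and the whole
   by the weight. *)
move: (\sum_(i < k) _) (weight k) (estimate k _) (estimate k _) (bregman _ _ _).
move: (dotp _ _) (dotp _ _) (dotp _ _) (dotp _ _) => fz' fw' fw fz.
move=> T S E0 E B IH zmin breg opt lip S_gt0.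
move: (N (w k.+1 - z k.+1)) (N (w k.+1 - z k)) (N (w k - z k)) (N (z k - z k.+1))
  (N (w k.+1 - w k)) IH zmin breg opt lip => p q r m e IH zmin breg opt lip desc.
have scaled_lip : alpha / L * (fw' - fz' - (fz - fw)) <= alpha * (e * p).
  rewrite [leRHS](_ : _ = alpha / L * (L * e * p)); last by field; rewrite gt_eqF.
  by rewrite ler_pM2l // divr_gt0.
have scaled_opt : gamma * (alpha / L * (fz - fw) + 2^-1 * p ^+ 2)
    + 2^-1 * q ^+ 2 <= 2^-1 * m ^+ 2.
  move: opt; rewrite -(ler_pM2l gamma_gt0) !mulrDr !mulVKf ?gt_eqF //; lra.
have scaled_breg : alpha * gamma * sigma / L / 2 * p ^+ 2 <= alpha * sigma / L * B.
  rewrite [leLHS](_ : _ = alpha * sigma / L * (gamma / 2 * p ^+ 2)); last by ring.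
  by rewrite ler_wpM2l // divr_ge0 ?mulr_ge0 // ltW.
have gamma_lip := ler_wpM2l (ltW gamma_gt0) scaled_lip.
have : S * (gamma / 16 * (q + r) ^+ 2
     + gamma / 4 * (1 + alpha * gamma * sigma / L) * p ^+ 2)
  <= S * (gamma / 4 * r ^+ 2 + 2^-1 * m ^+ 2
     + alpha * gamma / L * (fz' - fw') + alpha * sigma / L * B).
  by rewrite ler_pM2l //; lra.
rewrite [alpha * gamma / L * S * _](_ : _ =
  S * (alpha * gamma / L * (fz' - fw') + alpha * sigma / L * B)); first by lra.
by field; rewrite !gt_eqF.
Qed.

(** The optimality condition of the prox step defining [w_(k+1)] bounds
    [<F w_k, w_(k+1) - y>] through the gradient of [phi], itself at most
    [delta * N (w_(k+1) - z_k)]; replacing [F w_k] by [F w_(k+1)] costs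
    [L * N (w_(k+1) - w_k)]. *)
Lemma optDE_gap k y : W y ->
  dotp (F (w k.+1)) (w k.+1 - y)
  <= (1 + delta / (alpha * gamma)) * (L * res k.+1) * N (w k.+1 - y).
Proof.
move=> Wy.
have := variational (z k) ((alpha / L) *: F (w k)) Wy.
rewrite -optDE_wS dotpZl => opt.
have lip := lipschitz_dotp (w k.+1 - y) (optDE_w_in k.+1) (optDE_w_in k).
have tri := is_norm_triangle N_norm (w k.+1) (z k) (w k).
rewrite (is_normC N_norm (z k)) in tri.
have cs := dotp_le_dual_norm N_norm (phi_continuous N_assum) (y - w k.+1)
  (gradient (phi N) (w k.+1 - z k)).
have [_ _ /(_ (w k.+1 - z k)) grad] := N_assum.
have n0 := is_norm_ge0 N_norm (w k.+1 - y).
have r0 := is_norm_ge0 N_norm (w k - z k).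
have -> : res k.+1 = N (w k.+1 - z k) + N (w k - z k) by [].
rewrite (is_normC N_norm y) in cs.
have grad_term : dotp (gradient (phi N) (w k.+1 - z k)) (y - w k.+1)
    <= delta * (N (w k.+1 - z k) + N (w k - z k)) * N (w k.+1 - y).
  apply: le_trans cs _; rewrite ler_wpM2r //; apply: le_trans grad _.
  by rewrite ler_pM2l // lerDl.
have lip_term : dotp (F (w k.+1) - F (w k)) (w k.+1 - y)
    <= L * (N (w k.+1 - z k) + N (w k - z k)) * N (w k.+1 - y).
  by apply: le_trans lip _; rewrite ler_wpM2r // ler_pM2l.
have opt_term : dotp (F (w k)) (w k.+1 - y) <=
    L / (alpha * gamma) * dotp (gradient (phi N) (w k.+1 - z k)) (y - w k.+1).
  have La0 : 0 < L / alpha by rewrite divr_gt0.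
  rewrite -(pmulr_rge0 _ La0) in opt.
  rewrite -subr_ge0; apply: le_trans opt _; rewrite le_eqVlt; apply/orP; left.
  by apply/eqP; rewrite !dotpBr; field; rewrite !gt_eqF.
have Lag : 0 < L / (alpha * gamma) by rewrite divr_gt0 // mulr_gt0.
have := ler_wpM2l (ltW Lag) grad_term.
rewrite dotpBl in lip_term; move: lip_term opt_term.
rewrite [X in _ -> _ -> _ -> _ <= X](_ : _ =
  L * (N (w k.+1 - z k) + N (w k - z k)) * N (w k.+1 - y)
  + L / (alpha * gamma) *
    (delta * (N (w k.+1 - z k) + N (w k - z k)) * N (w k.+1 - y))).
  by lra.
by field; rewrite !gt_eqF.
Qed.

(** Comparing the two bounds on the estimate function at [z_(K+1)], with the sum
    of the weights given by [sum_weight]. This yields [A (K + 1)] in place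
    of [A K + a 1], which is at most as large since the steps increase. *)
Lemma residual_bound wstar K (m : R) :
  sigma_weak_solution N W F gamma sigma w0 wstar ->
  0 <= m -> (forall k, (1 <= k <= K.+1)%N -> m <= res k) ->
  L * m <= Num.sqrt (8 * alpha / gamma) * N (w0 - wstar)
           * Num.sqrt (L / (A K + a 1)).
Proof.
move=> sol m0 m_le; have [Wstar _] := sol.
have Aa0 : 0 < A K + a 1 by rewrite ltr_wpDl ?optDE_A_ge0 ?optDE_a_gt0.
have up := estimate_le_at_solution K.+1 sol.
have := le_trans (estimate_strong_min K.+1 Wstar) up.
have wN : 0 <= weight K.+1 / 2 * N (wstar - z K.+1) ^+ 2.
  by rewrite mulr_ge0 ?sqr_ge0 // divr_ge0 // ltW // weight_gt0.
have low := potential_lower_bound K.+1.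
have pN : 0 <= gamma / 4 * weight K.+1 * N (w K.+1 - z K.+1) ^+ 2.
  rewrite mulr_ge0 ?sqr_ge0 // mulr_ge0 ?(ltW (weight_gt0 _)) //.
  by rewrite divr_ge0 // ltW.
have : (\sum_(i < K.+1) weight i) * m ^+ 2 <=
    \sum_(i < K.+1) weight i * res i.+1 ^+ 2.
  rewrite mulr_suml; apply: ler_sum => i _.
  have m_res : m <= res i.+1 by apply: m_le; rewrite ltn_ord.
  by rewrite ler_pM2l ?weight_gt0 // lerXn2r ?nnegrE // (le_trans m0).
have := sum_weight K.+1; have AA := optDE_A_add_a1 K.
rewrite /phi (is_normC N_norm wstar w0).
have n0 := is_norm_ge0 N_norm (w0 - wstar).
move: (N (w0 - wstar)) n0 (\sum_(i < K.+1) weight i) => n n0 T TE Tm final.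
have Tm_le : gamma / 16 * (T * m ^+ 2) <= gamma^-1 * (2^-1 * n ^+ 2).
  apply: le_trans
    (_ : gamma / 16 * (\sum_(i < K.+1) weight i * res i.+1 ^+ 2) <= _).
    by rewrite ler_pM2l // divr_gt0.
  lra.
have Am_le : A K.+1 * m ^+ 2 <= 8 * alpha / gamma * n ^+ 2 / L.
  rewrite -TE.
  rewrite [leLHS](_ : _ = 16 * alpha / L * (gamma / 16 * (T * m ^+ 2)));
    last by field; rewrite gt_eqF.
  rewrite [leRHS](_ : _ = 16 * alpha / L * (gamma^-1 * (2^-1 * n ^+ 2)));
    last by field; rewrite !gt_eqF.
  by rewrite ler_pM2l // divr_gt0 // mulr_gt0.
have sq_le : (L * m) ^+ 2 <= 8 * alpha / gamma * n ^+ 2 * (L / (A K + a 1)).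
  rewrite mulrA ler_pdivlMr //.
  apply: le_trans (_ : L ^+ 2 * (A K.+1 * m ^+ 2) <= _).
    rewrite exprMn -mulrA ler_pM2l ?exprn_gt0 // mulrC ler_wpM2r ?sqr_ge0 //.
  apply: le_trans (ler_wpM2l (sqr_ge0 L) Am_le) _.
  rewrite le_eqVlt; apply/orP; left; apply/eqP.
  by field; rewrite !gt_eqF.
have c0 : 0 <= 8 * alpha / gamma by rewrite divr_ge0 ?mulr_ge0 // ltW.
have Lm0 : 0 <= L * m by rewrite mulr_ge0 // ltW.
rewrite -[leLHS]ger0_norm // -sqrtr_sqr; apply: le_trans (ler_wsqrtr sq_le) _.
have cn0 : 0 <= 8 * alpha / gamma * n ^+ 2 by rewrite mulr_ge0 ?sqr_ge0.
by rewrite (sqrtrM _ cn0) (sqrtrM _ c0) sqrtr_sqr ger0_norm.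
Qed.

End OptDE_analysis.

(** * The convergence rate *)

Theorem theorem1 (R : realType) (d : nat) (W : set 'rV[R]_d)
    (N : 'rV[R]_d -> R) (F : 'rV[R]_d -> 'rV[R]_d)
    (L gamma delta sigma alpha D : R) (K : nat)
    (w0 wstar wtilde : 'rV[R]_d)
    (hWclosed : closed W)
    (hWconvex : convex_set (W : set (convex_lmodType 'rV[R]_d)))
    (hN : is_norm N)
    (hgamma : 0 < gamma <= 1) (hdelta : 0 < delta)
    (hNassump : norm_assumption N gamma delta)
    (hL : 0 < L) (hF : lipschitz_operator N W F L)
    (hw0 : W w0)
    (hsol : (sigma = 0 /\ weak_solution W F wstar) \/
            (0 < sigma /\ sigma_weak_solution N W F gamma sigma w0 wstar))
    (hD : 0 < D) (hK : (1 <= K)%N)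
    (halpha : 0 < alpha <= Num.min (1 / (4 * Num.sqrt 2))
                                   (Num.sqrt 3 / (4 * Num.sqrt gamma)))
    (hout : optDE_output N W F L gamma sigma alpha w0 K wtilde) :
  let C0 := (1 + delta / (alpha * gamma)) * Num.sqrt (8 * alpha / gamma) in
  let a1 := optDE_a L gamma sigma alpha 1 in
  let A := optDE_A L gamma sigma alpha K.-1 in
  [/\ a1 = alpha * gamma / L,
      A = (if sigma == 0 then alpha * gamma * K.-1%:R / L
           else 1 / sigma * (1 + alpha * gamma * sigma / L) ^+ K.-1
                - 1 / sigma),
      (ereal_sup [set (dotp (F wtilde) (wtilde - w))%:E
                 | w in [set w | W w /\ (N (wtilde - w) <= D)%R]]
       <= (C0 * D * N (w0 - wstar) * Num.sqrt (L / (A + a1)))%:E)%E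
    & 0 < sigma ->
      N (wtilde - wstar)
      <= C0 / sigma * N (w0 - wstar) * Num.sqrt (L / (A + a1))].
Proof.
move=> C0 a1 A.
have [gamma_gt0 gamma_le1] := andP hgamma.
have [alpha_gt0 alpha_le] := andP halpha.
have alpha_small : alpha ^+ 2 <= 32^-1.
  move: alpha_le; rewrite le_min => /andP[alpha_le _].
  have s2 : 0 < 1 / (4 * Num.sqrt 2) :> R.
    by rewrite divr_gt0 // mulr_gt0 // sqrtr_gt0.
  have {}alpha_le : alpha ^+ 2 <= (1 / (4 * Num.sqrt 2)) ^+ 2.
    by rewrite lerXn2r // nnegrE ltW.
  apply: le_trans alpha_le _; rewrite expr_div_n exprMn sqr_sqrtr // expr1n.
  lra.
have sigma_ge0 : 0 <= sigma by case: hsol => [[-> _]|[/ltW]].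
(* for sigma = 0 the two notions of solution coincide *)
have sol : sigma_weak_solution N W F gamma sigma w0 wstar.
  case: hsol => [[-> [Ws weak]]|[_ //]]; split=> // y Wy.
  by rewrite !mul0r weak.
have [Wstar strong_sol] := sol.
case: hout => -[|k] [//= kK k_min ->].
set w := optDE_w _ _ _ _ _ _ _ _.
set res := optDE_residual N W F L gamma sigma alpha w0 in k_min.
have bound : L * res k.+1 <= Num.sqrt (8 * alpha / gamma) * N (w0 - wstar)
           * Num.sqrt (L / (A + a1)).
  apply: (residual_bound hWclosed hWconvex hN gamma_gt0 gamma_le1 hNassump hL
    hF hw0 sigma_ge0 alpha_gt0 alpha_small sol).
    by rewrite /res /optDE_residual addr_ge0 // is_norm_ge0.
  by rewrite prednK.
have c0 : 0 <= 1 + delta / (alpha * gamma).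
  by rewrite addr_ge0 // divr_ge0 ?mulr_ge0 // ltW.
have gap y : W y -> dotp (F (w k.+1)) (w k.+1 - y) <=
    C0 * N (w0 - wstar) * Num.sqrt (L / (A + a1)) * N (w k.+1 - y).
  move=> Wy; have := optDE_gap sigma hWclosed hWconvex hN gamma_gt0 hNassump hL hF
    hw0 hdelta alpha_gt0 k Wy.
  move=> /le_trans; apply; rewrite ler_wpM2r ?is_norm_ge0 // /C0.
  by rewrite -2![X in _ <= X]mulrA ler_wpM2l // mulrA.
have C0_ge0 : 0 <= C0 by rewrite mulr_ge0 ?sqrtr_ge0.
have coef_ge0 : 0 <= C0 * N (w0 - wstar) * Num.sqrt (L / (A + a1)).
  by rewrite !mulr_ge0 ?sqrtr_ge0 ?is_norm_ge0.
split.
- by rewrite /a1 /optDE_a /= mulr0 addr0 mulr1.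
- have [s0|s0] := eqVneq sigma 0.
    rewrite /A -sum_weight (eq_bigr (fun=> 1)) => [|i _].
      by rewrite sumr_const card_ord mulrAC.
    by rewrite s0 mul0r addr0.
  have := optDE_A_closed_form L gamma sigma alpha K.-1.
  by rewrite -/A => /(canRL (mulKf s0)) ->; rewrite mulrBr mulr1 div1r.
- apply: ge_ereal_sup => _ [y [Wy yD] <-]; rewrite lee_fin.
  apply: le_trans (gap y Wy) _.
  rewrite [leRHS](_ : _ = C0 * N (w0 - wstar) * Num.sqrt (L / (A + a1)) * D).
    by rewrite ler_wpM2l.
  by ring.
- move=> sigma_gt0.
  have strong : sigma * N (w k.+1 - wstar) ^+ 2
      <= dotp (F (w k.+1)) (w k.+1 - wstar).
    have Wk : W (w k.+1).
      exact: (optDE_w_in F L sigma alpha hWclosed hN gamma_gt0 hNassump hw0).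
    apply: le_trans (strong_sol _ Wk).
    have b1 := bregman_ge hNassump (w k.+1 - w0) (wstar - w0).
    have b2 := bregman_ge hNassump (wstar - w0) (w k.+1 - w0).
    rewrite opprB subrKA (is_normC hN) in b1; rewrite opprB subrKA in b2.
    rewrite [leLHS](_ : _ = sigma / gamma * (gamma / 2 * N (w k.+1 - wstar) ^+ 2
        + gamma / 2 * N (w k.+1 - wstar) ^+ 2)).
      by rewrite ler_wpM2l ?lerD // divr_ge0 // ltW.
    by field; rewrite gt_eqF.
  have key := le_trans strong (gap _ Wstar).
  rewrite [leRHS](_ : _ = (C0 * N (w0 - wstar) * Num.sqrt (L / (A + a1))) / sigma);
    last by ring.
  have [->|n0] := eqVneq (N (w k.+1 - wstar)) 0.
    by rewrite divr_ge0 // ltW.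
  have n_gt0 : 0 < N (w k.+1 - wstar).
    by rewrite lt_neqAle eq_sym n0 is_norm_ge0.
  by rewrite expr2 mulrA ler_pM2r // mulrC in key; rewrite ler_pdivlMr.
Qed.
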